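(* For $n\ge2$, $$\sum_{\pi\in\mathrm{PF}(n)}x^{\mathrm{nlel}(\pi)}y^{\mathrm{one}(\pi)}z^{\mathrm{unl}(\pi)}=xy\Big((n-1)\prod_{i=1}^{n-2}\big(xz+yz+(i-1)z+n-i\big)+(xyz+1)\prod_{i=1}^{n-2}\big(xyz+iz+n-i\big)\Big).$$
   Context: $\mathrm{PF}(n)$ is the set of parking functions of length $n$: sequences of positive integers whose increasing rearrangement $b_1\le\dots\le b_n$ satisfies $b_i\le i$; equivalently all cars park under the classical protocol (cars $1,\dots,n$ arrive in order, car $i$ parks in the first unoccupied spot among $\pi_i,\pi_i+1,\dots,n$). $\mathrm{unl}(\pi)$ is the number of cars not parking in their preferred spot, $\mathrm{nlel}(\pi)=\#\{i:\pi_i=\pi_2\}$, $\mathrm{one}(\pi)=\#\{i:\pi_i=1\}$. *)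

(* Defs.v *)
From mathcomp Require Import all_boot.

Set Implicit Arguments.
Unset Strict Implicit.
Unset Printing Implicit Defensive.

(* Cars, spots and preferences have values 1, ..., n as in the usual
   convention, while positions in a sequence are counted from 0: the i-th
   entry (i >= 1) of s is nth 0 s i.-1. *)

Definition parking (s : seq nat) : bool :=
  all (leq 1) s && [forall i : 'I_(size s), nth 0 (sort leq s) i <= i.+1].

Definition parkseq n (t : n.-tuple 'I_n.+1) : seq nat := map val t.

(* The type 'I_n.+1 = {0, ..., n} only makes the index set finite: the value 0
   is excluded by parking, and no parking function has an entry larger than
   its length (see parkingE). *)
Definition PF n : {set n.-tuple 'I_n.+1} := [set t | parking (parkseq t)].

Lemma parkingE n (s : seq nat) :
  (size s == n) && parking s <-> exists2 t, t \in PF n & parkseq t = s.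
Proof.
split=> [/andP[/eqP sz_s ps]|[t]]; last first.
  by rewrite inE => pt <-; rewrite pt size_map size_tuple eqxx.
have s_le : all (fun k => k < n.+1) s.
  apply/allP=> k ks; have /andP[_ /forallP le_s] := ps.
  have k_sort : k \in sort leq s by rewrite mem_sort.
  have lt_i : index k (sort leq s) < size s.
    by rewrite -(size_sort leq s) index_mem.
  have := le_s (Ordinal lt_i); rewrite /= nth_index // ltnS => /leq_trans.
  by apply; rewrite -sz_s.
pose t := map (inord : nat -> 'I_n.+1) s.
have sz_t : size t == n by rewrite size_map sz_s.
have t_s : parkseq (Tuple sz_t) = s.
  rewrite /parkseq /= -map_comp -[RHS]map_id; apply/eq_in_map=> k ks /=.
  by rewrite inordK //; apply: (allP s_le).
by exists (Tuple sz_t) => //; rewrite inE t_s.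
Qed.

(* A car with preference p takes the first of the spots p, p + 1, ..., n not
   in occ; occ lists the spots taken by the previous cars, in order of arrival,
   with None for a car that could not park. *)
Definition park_car n (occ : seq (option nat)) (p : nat) : seq (option nat) :=
  rcons occ (ohead [seq j <- iota p (n.+1 - p) | Some j \notin occ]).

Definition outcome (s : seq nat) : seq (option nat) :=
  foldl (park_car (size s)) [::] s.

Definition unl (s : seq nat) : nat :=
  \sum_(i < size s) (nth None (outcome s) i != Some (nth 0 s i)).

Definition nlel (s : seq nat) : nat := count_mem (nth 0 s 1) s.

Definition ones (s : seq nat) : nat := count_mem 1 s.

(* Main.v *)
Require Import Defs.
From mathcomp Require Import all_boot all_algebra ring zify.

(* The number of unlucky cars is unaffected by exchanging the first two cars, so
   nlel may be replaced by the number of cars sharing the preference q of the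
   first car. Give preference p the weight x^[p = q] y^[p = 1], and attach to
   every free spot a value, the total weight of the preferences leading to it:
   its own weight plus z times the weight of the occupied block just before it.
   Parking a car at a free spot of value a costs a factor a and, when the spot
   itself weighs 1, merges a and the next value b into a + b + z - 1. An extra
   spot that has to remain empty closes up the street to a circle, and summing
   over q becomes summing over all rotations of one sequence of values. As in
   Pollak's circle argument this sum factors, because each parking changes the
   total value by z - 1. For the induction one needs the sums in which the first
   k values of each rotation have been collected in one spot. *)

Set Implicit Arguments.
Unset Strict Implicit.
Unset Printing Implicit Defensive.

Import GRing.Theory.
Local Open Scope ring_scope.

(** * Rotations of sequences of values *)

Section Rotations.
Variables (A : Type) (R : nmodType).
Implicit Types (s : seq A) (g : seq A -> R).

Lemma sum_rotS g s :
  \sum_(r < size s) g (rot r.+1 s) = \sum_(r < size s) g (rot r s).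
Proof.
case sz_s: (size s) => [|m]; first by rewrite !big_ord0.
by rewrite big_ord_recr [RHS]big_ord_recl /= rot0 -sz_s rot_size addrC.
Qed.

Lemma sum_rot_rot g j s :
  \sum_(r < size s) g (rot j (rot r s)) = \sum_(r < size s) g (rot r s).
Proof.
elim: j g => [|j IHj] g; first by apply: eq_bigr => r _; rewrite rot0.
case: (ltnP j (size s)) => js; last first.
  by apply: eq_bigr => r _; rewrite rot_oversize // size_rot leqW.
rewrite -[RHS]sum_rotS.
under [RHS]eq_bigr => r _ do rewrite rotS //.
rewrite -(IHj (fun t => g (rot 1 t))).
by apply: eq_bigr => r _; rewrite rotS // size_rot.
Qed.

Lemma sum_rotr g s :
  \sum_(r < size s) g (rotr r s) = \sum_(r < size s) g (rot r s).
Proof.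
rewrite -sum_rotS (reindex_inj rev_ord_inj) /=; apply: eq_bigr => r _.
by rewrite /rotr subKn.
Qed.

End Rotations.

(** * Merging values and summing filling weights over rotations *)

Section Merging.
Variables (R : comNzRingType) (z : R).
Implicit Types (c a b : R) (s w : seq R).

(* Effect on the values when the free spot number i is filled. *)
Fixpoint merge_at i s : seq R :=
  match i, s with
  | 0, [:: a, b & t] => a + b + (z - 1) :: t
  | i'.+1, a :: t => a :: merge_at i' t
  | _, _ => s
  end.

Lemma merge_at_cat s1 s2 i : merge_at (size s1 + i) (s1 ++ s2) = s1 ++ merge_at i s2.
Proof. by elim: s1 => //= a s1 ->. Qed.

Lemma size_merge_at i s : (i.+1 < size s)%N -> size (merge_at i s) = (size s).-1.
Proof.
elim: i s => [|i IHi] [|a [|b s]] //= lt_is.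
by rewrite IHi.
Qed.

Lemma sum_merge_at i s : (i.+1 < size s)%N ->
  \sum_(a <- merge_at i s) a = \sum_(a <- s) a + (z - 1).
Proof.
elim: i s => [|i IHi] [|a [|b s]] // lt_is; rewrite /= !big_cons.
  by rewrite -/(merge_at _ _) ?big_cons; ring.
by rewrite IHi // !big_cons !addrA.
Qed.

(** Rotation by [j] brings the two values to be merged to the front and leaves the [j] values sent
    to the end intact, so [rotr j] restores them although the sequence is now one shorter. *)
Lemma merge_at_rot j s : (j.+1 < size s)%N -> merge_at j s = rotr j (merge_at 0 (rot j s)).
Proof.
move=> lt_js; have sz_t : size (take j s) = j by rewrite size_takel //; lia.
rewrite -{1}[s](cat_take_drop j) -{1}[j]addn0 -{1}sz_t merge_at_cat /rot.
rewrite (drop_nth 0) ?(drop_nth 0 (n := j.+1)) /=; try lia.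
by rewrite -cat_cons -[X in rotr X _]sz_t rotr_size_cat.
Qed.

Lemma nth0_rot j s : (j < size s)%N -> (rot j s)`_0 = s`_j.
Proof. by move=> lt_js; rewrite /rot (drop_nth 0). Qed.

Lemma sum_rot_nth s j : (j < size s)%N ->
  \sum_(r < size s) (rot r s)`_j = \sum_(a <- s) a.
Proof.
move=> lt_js.
under eq_bigr => r _ do rewrite -nth0_rot ?size_rot //.
rewrite (sum_rot_rot (fun t => t`_0)) (big_nth 0) big_mkord.
by apply: eq_bigr => r _; rewrite nth0_rot.
Qed.

Lemma sum_rot_take s k : (k <= size s)%N ->
  \sum_(r < size s) \sum_(a <- take k (rot r s)) a = k%:R * \sum_(a <- s) a.
Proof.
move=> le_ks; transitivity (\sum_(r < size s) \sum_(j < k) (rot r s)`_j).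
  apply: eq_bigr => r _; rewrite (big_nth 0) size_takel ?size_rot // big_mkord.
  by apply: eq_bigr => j _; rewrite nth_take.
rewrite exchange_big /=.
under eq_bigr => j _ do rewrite sum_rot_nth ?(leq_trans (ltn_ord j)) //.
by rewrite sumr_const card_ord mulr_natl.
Qed.

(** For fixed [j], shifting all rotations by [j] moves the filled spot to the front. The merged
    sequence has length [(size s).-1], so [j] then runs once through all its rotations, as an
    induction on the length requires. *)
Lemma sum_rot_merge (g : seq R -> R) s :
  \sum_(r < size s) \sum_(j < (size s).-1) (rot r s)`_j * g (merge_at j (rot r s))
  = \sum_(r < size s)
      (rot r s)`_0 * \sum_(j < (size s).-1) g (rot j (merge_at 0 (rot r s))).
Proof.
transitivity (\sum_(r < size s) \sum_(j < (size s).-1)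
                (rot r s)`_0 * g (rotr j (merge_at 0 (rot r s)))).
  rewrite exchange_big [RHS]exchange_big; apply: eq_bigr => j _ /=.
  rewrite -(sum_rot_rot (fun t => t`_0 * g (rotr j (merge_at 0 t))) j).
  apply: eq_bigr => r _.
  have lt_j : (j.+1 < size (rot r s))%N by rewrite size_rot -ltn_predRL.
  by rewrite (merge_at_rot lt_j) (nth0_rot (ltnW lt_j)).
apply: eq_bigr => r _; rewrite -mulr_sumr; congr (_ * _).
have [lt1s|le_s1] := ltnP 1 (size s); last first.
  by have -> : (size s).-1 = 0%N; [lia | rewrite !big_ord0].
have <- : size (merge_at 0 (rot r s)) = (size s).-1 by rewrite size_merge_at size_rot.
exact: sum_rotr.
Qed.

(* Total weight of the ways to fill k of the free spots with values s; the last
   spot is never filled when size s = k.+1. *)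
Fixpoint fills k s : R :=
  if k is k'.+1 then \sum_(i < k) s`_i * fills k' (merge_at i s) else 1.

Definition window k c s := c + \sum_(a <- take k s) a :: drop k s.
Arguments window : simpl never.

Lemma merge_at_window k c s : (k < size s)%N ->
  merge_at 0 (window k c s) = window k.+1 (c + (z - 1)) s.
Proof.
move=> lt_ks; rewrite /window (drop_nth 0) //= (take_nth 0) // big_rcons /=.
by congr (_ :: _); ring.
Qed.

(** For every [i < k] the first [k] merged values absorb the first [k.+1] old ones plus [z - 1]. By
    [merge_at_window], filling the collected spot itself has the same effect. *)
Lemma window_merge_lt k c s i : (i < k < size s)%N ->
  window k c (merge_at i s) = window k.+1 (c + (z - 1)) s.
Proof.
rewrite /window; elim: i k c s => [|i IHi] [|k] c [|a [|b s]] lt_iks;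
  try by move: lt_iks; rewrite /= ?ltnS ?ltn0 ?andbF.
  by rewrite /= !big_cons; congr (_ :: _); ring.
have := IHi k (c + a) (b :: s) lt_iks; rewrite /= !big_cons !addrA.
by case=> -> ->; congr (_ :: _); ring.
Qed.

Lemma window_merge_ge k c s i : (k <= size s)%N ->
  window k c (merge_at (k + i) s) = merge_at i.+1 (window k c s).
Proof.
move=> le_ks; have sz_t := size_takel le_ks.
rewrite -{1}[s](cat_take_drop k) -{2}sz_t merge_at_cat /window /=.
by rewrite take_size_cat ?drop_size_cat.
Qed.

(** Filling the collected spot costs [c] plus the first [k] values. Only [c] stays apart: by
    [window_merge_lt] each of these values can be charged to a merge inside [s]. With the later
    spots this gives a sum over all merges of [s], ready for [sum_rot_merge]. *)
Lemma fills_window f k c s : size s = (k + f.+1)%N ->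
  fills f.+1 (window k c s) =
    c * fills f (window k.+1 (c + (z - 1)) s)
    + \sum_(j < (size s).-1) s`_j * fills f (window k c (merge_at j s)).
Proof.
move=> sz_s; rewrite /= -/(window k c s).
have -> : (size s).-1 = (k + f)%N by lia.
rewrite big_ord_recl big_split_ord merge_at_window ?sz_s; last lia.
rewrite [X in X * fills f _]/= mulrDl -addrA; congr (_ + (_ + _)).
  rewrite (big_nth 0) size_takel ?sz_s; last lia.
  rewrite big_mkord mulr_suml; apply: eq_bigr => j _.
  have lt_jks : (j < k < size s)%N by rewrite ltn_ord sz_s; lia.
  by rewrite nth_take // window_merge_lt.
apply: eq_bigr => i _; rewrite lift0 [rshift _ _ : nat]/= window_merge_ge ?sz_s; last lia.
by rewrite /window /= nth_drop.
Qed.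

Lemma prod_arith c f :
  \prod_(1 <= i < f.+2) (c + i%:R * (z - 1)) =
  (c + (z - 1)) * \prod_(1 <= i < f.+1) (c + (z - 1) + i%:R * (z - 1)).
Proof.
rewrite big_ltn // mul1r big_add1 /=; congr (_ * _).
by apply: eq_bigr => i _; rewrite -[i.+1]addn1 natrD; ring.
Qed.

(** Induction on [f] through [fills_window]. With m = |s| - 1 the linear factors combine as c(|s|(c
    + z - 1) + (k + 1)S) + S(mc + k(S + z - 1)) = (|s|c + kS)(c + S + z - 1). *)
Lemma sum_rot_fills_window f k c s (S := \sum_(a <- s) a) :
  size s = (k + f.+1)%N ->
  \sum_(r < size s) fills f.+1 (window k c (rot r s)) =
  ((size s)%:R * c + k%:R * S) * \prod_(1 <= i < f.+1) (c + S + i%:R * (z - 1)).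
Proof.
rewrite {}/S; elim: f k c s => [|f IHf] k c s sz_s.
  rewrite big_geq // mulr1 -sum_rot_take; last lia.
  transitivity (\sum_(r < size s) (c + \sum_(a <- take k (rot r s)) a)).
    by apply: eq_bigr => r _; rewrite /= big_ord1 mulr1.
  by rewrite big_split /= sumr_const card_ord mulr_natl.
have sz_r r : size (rot r s) = (k + f.+2)%N by rewrite size_rot.
have mE : size s = (size s).-1.+1 by lia.
rewrite (eq_bigr _ (fun (r : 'I_(size s)) _ => fills_window c (sz_r r))).
under eq_bigr => r _ do rewrite size_rot.
rewrite big_split /= -mulr_sumr IHf; last lia.
rewrite (sum_rot_merge (fun t => fills f.+1 (window k c t))).
set V := \sum_(a <- s) a; set m := (size s).-1 in mE *.
(* Both halves share this product: one raises [c] by [z - 1], the other raises the total [V] by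
   [z - 1]. *)
pose P := \prod_(1 <= i < f.+1) (c + V + (z - 1) + i%:R * (z - 1)).
rewrite (eq_bigr (fun r : 'I_(size s) =>
    (rot r s)`_0 * ((m%:R * c + k%:R * (V + (z - 1))) * P))); last first.
  move=> r _; congr (_ * _); pose t := merge_at 0 (rot r s).
  have sz_t : size t = m by rewrite size_merge_at size_rot //; lia.
  have sum_t : \sum_(a <- t) a = V + (z - 1).
    rewrite sum_merge_at ?size_rot; last lia.
    by congr (_ + _); apply: perm_big; rewrite perm_rot.
  rewrite -sz_t IHf ?sum_t ?sz_t; last lia.
  by congr (_ * _); apply: eq_bigr => i _; ring.
rewrite -mulr_suml (sum_rot_nth (j := 0)); last lia.
rewrite -/V prod_arith -/P.
rewrite [X in c * (_ * X)](_ : _ = P); last by apply: eq_bigr => i _; ring.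
rewrite mE -[m.+1]addn1 -[k.+1]addn1 !natrD; ring.
Qed.

(* Filling weights when s is preceded by spot 1, still free. Filling spot 1 adds
   c + z - 1 to the next value, but costs y instead of c; this constant factor is
   left out here. *)
Fixpoint gapped k c s : R :=
  if k is k'.+1 then
    fills k' (window 1 (c + (z - 1)) s)
    + \sum_(i < k') s`_i * gapped k' c (merge_at i s)
  else 1.
Arguments gapped : simpl never.

(** Filling spot 1 gives a window sum with factor |s|(c + z - 1) + S, and the other merges add (|s|
    - 1)S. Together they make |s|(c + S + z - 1), the new factor of the product. *)
Lemma sum_rot_gapped k c s (S := \sum_(a <- s) a) : size s = k.+1 ->
  \sum_(r < size s) gapped k.+1 c (rot r s) =
  (size s)%:R * \prod_(1 <= i < k.+1) (c + S + i%:R * (z - 1)).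
Proof.
rewrite {}/S; elim: k s => [|k IHk] s sz_s.
  by rewrite sz_s big_ord1 big_geq // /gapped big_ord0 /= addr0 mulr1.
set V := \sum_(a <- s) a.
pose P := \prod_(1 <= i < k.+1) (c + V + (z - 1) + i%:R * (z - 1)).
transitivity (\sum_(r < size s) (fills k.+1 (window 1 (c + (z - 1)) (rot r s))
    + \sum_(i < (size s).-1) (rot r s)`_i * gapped k.+1 c (merge_at i (rot r s)))).
  have -> : (size s).-1 = k.+1 by rewrite sz_s.
  by [].
rewrite big_split /= (sum_rot_merge (gapped k.+1 c)).
rewrite sum_rot_fills_window ?sz_s // -/V prod_arith -/P.
have -> : \prod_(1 <= i < k.+1) (c + (z - 1) + V + i%:R * (z - 1)) = P.
  by apply: eq_bigr => i _; ring.
rewrite (eq_bigr (fun r : 'I_k.+2 => (rot r s)`_0 * (k.+1%:R * P))); last first.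
  move=> r _; congr (_ * _); pose t := merge_at 0 (rot r s).
  have sz_t : size t = k.+1 by rewrite size_merge_at size_rot sz_s.
  have sum_t : \sum_(a <- t) a = V + (z - 1).
    rewrite sum_merge_at ?size_rot ?sz_s //.
    by congr (_ + _); apply: perm_big; rewrite perm_rot.
  have := IHk t sz_t; rewrite sz_t sum_t => IHt.
  apply: etrans IHt _; congr (_ * _).
  by apply: eq_bigr => i _; ring.
have := @sum_rot_nth s 0; rewrite sz_s -mulr_suml => -> //; rewrite -/V.
rewrite -[in k.+2]addn1 natrD; ring.
Qed.

(** All rotations of the ones coincide, but the multiplicity in [sum_rot_fills_window] cannot be
    cancelled in a general ring. So one spot is filled first: merging at [j] gives the rotation
    [rotr j t] of a single sequence [t], and the sum over [j] covers each rotation index once. *)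
Lemma fills_cons_nseq m c :
  fills m.+1 (c :: nseq m.+1 1) =
  c * \prod_(1 <= i < m.+1) (c + m.+1%:R + i%:R * (z - 1)).
Proof.
elim: m c => [|m IHm] c; first by rewrite big_geq //= big_ord1 /= !mulr1.
set s := nseq m.+2 1.
have -> : c :: s = window 0 c s by rewrite /window take0 big_nil addr0 drop0.
rewrite fills_window ?size_nseq //.
have -> : window 1 (c + (z - 1)) s = c + z :: nseq m.+1 1.
  by rewrite /window /= big_seq1; congr (_ :: _); ring.
have rot_s j : rot j s = s.
  have /all_pred1P -> : all (pred1 1) (rot j s).
    by rewrite (eq_all_r (mem_rot j s)) all_pred1_nseq.
  by rewrite size_rot size_nseq.
pose t := 1 + 1 + (z - 1) :: nseq m 1.
have sum_t : \sum_(a <- t) a = m.+1%:R + z.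
  by rewrite big_cons big_nseq iter_addr_0 -addn1 natrD; ring.
have sz_s : size s = m.+2 by rewrite size_nseq.
rewrite IHm prod_arith [m.+2.-1]/=.
rewrite (eq_bigr (fun j : 'I_m.+1 => fills m.+1 (window 0 c (rotr j t)))); last first.
  move=> j _; have lt_js : (j.+1 < size s)%N by rewrite sz_s ltnS ltn_ord.
  by rewrite (merge_at_rot lt_js) rot_s nth_nseq leqW // mul1r.
have sz_t : size t = m.+1 by rewrite /= size_nseq.
have := sum_rotr (fun w => fills m.+1 (window 0 c w)) t; rewrite sz_t => ->.
have := @sum_rot_fills_window m 0 c t sz_t; rewrite sz_t sum_t => ->.
pose P := \prod_(1 <= i < m.+1) (c + m.+2%:R + (z - 1) + i%:R * (z - 1)).
have -> : \prod_(1 <= i < m.+1) (c + z + m.+1%:R + i%:R * (z - 1)) = P.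
  by apply: eq_bigr => i _; rewrite -[m.+2]addn1 natrD; ring.
have -> : \prod_(1 <= i < m.+1) (c + (m.+1%:R + z) + i%:R * (z - 1)) = P.
  by apply: eq_bigr => i _; rewrite -[m.+2]addn1 natrD; ring.
rewrite -/P -[m.+2]addn1 natrD; ring.
Qed.

Lemma rotr_cons_nseq a m i : (i <= m)%N ->
  rotr i (a :: nseq m 1) = nseq i 1 ++ a :: nseq (m - i) 1.
Proof.
move=> le_im; rewrite -{1}(subnK le_im) nseqD -cat_cons.
by rewrite -{1}(size_nseq i (1 : R)) rotr_size_cat.
Qed.

End Merging.

(** * Values of the free spots *)

Section Holes.
Variables (R : comNzRingType) (z : R) (w : nat -> R).
Implicit Types (acc b : R) (O : pred nat) (f : nat -> R) (l : seq nat).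

Definition occupy j O : pred nat := fun i => (i == j) || O i.

(* acc is the weight of the occupied block just before l. The last entry is the
   value of the extra spot n + 1 that has to remain empty. *)
Fixpoint hole_values acc O l : seq R :=
  if l is p :: l' then
    if O p then hole_values (acc + w p) O l'
    else w p + z * acc :: hole_values 0 O l'
  else [:: 1 + z * acc].

Fixpoint hole_sum acc O f l : R :=
  if l is p :: l' then
    if O p then hole_sum (acc + w p) O f l'
    else (w p + z * acc) * f p + hole_sum 0 O f l'
  else 0.

Lemma eq_hole_values acc O O' l : {in l, O =1 O'} ->
  hole_values acc O l = hole_values acc O' l.
Proof.
elim: l acc => //= p l IHl acc eqO; rewrite eqO ?mem_head //.
have {}IHl a : hole_values a O l = hole_values a O' l.
  by apply: IHl => i li; rewrite eqO // mem_behead.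
by rewrite !IHl.
Qed.

Lemma eq_hole_sum acc O f f' l :
  (forall p, p \in l -> ~~ O p -> f p = f' p) ->
  hole_sum acc O f l = hole_sum acc O f' l.
Proof.
elim: l acc => //= p l IHl acc eqf.
have {}IHl a : hole_sum a O f l = hole_sum a O f' l.
  by apply: IHl => i li; apply: eqf; rewrite mem_behead.
by rewrite !IHl; case: ifP => // /negbT Op; rewrite eqf ?mem_head.
Qed.

Lemma size_hole_values acc O l :
  size (hole_values acc O l) = (count (predC O) l).+1.
Proof. by elim: l acc => //= p l IHl acc; case: (O p); rewrite /= IHl. Qed.

(** The block before [l] affects only the first value, which always exists thanks to the extra
    spot. *)
Lemma window_hole_values acc b O l :
  window 1 (z * b) (hole_values acc O l) = hole_values (acc + b) O l.
Proof.
elim: l acc => [|p l IHl] acc /=.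
  by rewrite /window /= big_seq1; congr [:: _]; ring.
case: (O p); first by rewrite IHl addrAC.
by rewrite /window /= take0 drop0 big_seq1; congr (_ :: _); ring.
Qed.

Lemma merge0_cons a s : (0 < size s)%N ->
  merge_at z 0 (a :: s) = window 1 (a + (z - 1)) s.
Proof.
case: s => //= b s _; rewrite /window /= take0 drop0 big_seq1.
by congr (_ :: _); ring.
Qed.

(** This justifies the rule of [merge_at]: filling a spot of weight 1 and value a = 1 + z acc adds
    acc + 1 to the block before the next free spot, whose value thus grows by z(acc + 1) = a + z -
    1. *)
Lemma hole_sum_merge (g : seq R -> R) acc O l :
  uniq l -> (forall p, p \in l -> ~~ O p -> w p = 1) ->
  hole_sum acc O (fun p => g (hole_values acc (occupy p O) l)) l =
  \sum_(i < count (predC O) l)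
    (hole_values acc O l)`_i * g (merge_at z i (hole_values acc O l)).
Proof.
elim: l acc g => [|p l IHl] acc g /=; first by rewrite big_ord0.
case/andP=> p'l uniq_l w1.
have w1l q : q \in l -> ~~ O q -> w q = 1.
  by move=> lq; apply: w1; rewrite mem_behead.
have occ_p q : q \in l -> occupy q O p = O p.
  by move=> lq; rewrite /occupy; case: eqP => // pq; rewrite pq lq in p'l.
case Op: (O p) => /=.
  rewrite add0n -IHl //; apply: eq_hole_sum => q lq _.
  by rewrite occ_p // Op.
have wp : w p = 1 by rewrite w1 ?mem_head ?Op.
rewrite add1n big_ord_recl merge0_cons ?size_hole_values //; congr (_ * g _ + _).
  rewrite /occupy eqxx /= -[X in hole_values X]add0r.
  rewrite (@eq_hole_values _ _ O) => [|q lq].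
    rewrite -(add0r (acc + w p)) -window_hole_values wp; congr window; ring.
  by case: eqP => // qp; rewrite -qp lq in p'l.
under [RHS]eq_bigr => i _ do rewrite lift0.
rewrite -(IHl _ (fun s => g (w p + z * acc :: s))) //.
by apply: eq_hole_sum => q lq _; rewrite occ_p ?Op.
Qed.

Lemma hole_sum_full acc O f l : count (predC O) l = 0%N ->
  hole_sum acc O f l = 0.
Proof. by elim: l acc => //= p l IHl acc; case: (O p) => //= /IHl. Qed.

Variable n : nat.

Fixpoint completions k O : R :=
  if k is k'.+1 then hole_sum 0 O (fun p => completions k' (occupy p O)) (iota 1 n)
  else 1.

Lemma count_occupy p O l : uniq l -> p \in l -> ~~ O p ->
  count (predC O) l = (count (predC (occupy p O)) l).+1.
Proof.
elim: l => //= q l IHl /andP[q'l uniq_l]; rewrite inE /occupy.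
case: eqP q'l => [<- p'l _ Op|/eqP neq_pq _ /= lp Op].
  rewrite eqxx /= (negPf Op) add0n add1n; congr _.+1; apply: eq_in_count => i li /=.
  by case: eqP => // ip; rewrite -ip li in p'l.
by rewrite IHl // eq_sym (negPf neq_pq) addnS.
Qed.

Lemma completions_fills k O : count (predC O) (iota 1 n) = k ->
  (forall p, p \in iota 1 n -> ~~ O p -> w p = 1) ->
  completions k O = fills z k (hole_values 0 O (iota 1 n)).
Proof.
elim: k O => // k IHk O count_k w1.
have := hole_sum_merge (fills z k) 0 (iota_uniq 1 n) w1.
rewrite count_k => sumE; apply: etrans sumE.
apply: eq_hole_sum => p lp Op; apply: IHk => [|q lq].
  by move: count_k; rewrite (count_occupy _ lp Op) ?iota_uniq // => -[].
by rewrite negb_or => /andP[_]; apply: w1.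
Qed.

Lemma completionsS k O : (0 < n)%N -> ~~ O 1%N ->
  completions k.+1 O = w 1%N * completions k (occupy 1%N O)
    + hole_sum 0 O (fun p => completions k (occupy p O)) (iota 2 n.-1).
Proof.
move=> n_gt0 /negPf O1; rewrite [LHS]/=; set F := fun p => _.
have -> : iota 1 n = 1%N :: iota 2 n.-1 by case: n n_gt0.
by rewrite /= O1 mulr0 addr0.
Qed.

Lemma completions_gapped k O (l := iota 2 n.-1) : (0 < n)%N -> ~~ O 1%N ->
  count (predC O) l = k ->
  (forall p, p \in l -> ~~ O p -> w p = 1) ->
  completions k.+1 O =
    w 1%N * gapped z k.+1 (1 + z * w 1%N - z) (hole_values 0 O l).
Proof.
(* [c + (z - 1)] is [z * w 1], the amount that filling spot 1 adds to the next value. *)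
move=> n_gt0; set c := 1 + _ - z.
have nE : iota 1 n = 1%N :: l by rewrite /l; case: n n_gt0.
have one'l : 1%N \notin l by rewrite mem_iota.
have uniq_l : uniq l by rewrite iota_uniq.
have fill1 i P : count (predC P) l = i ->
    (forall p, p \in l -> ~~ P p -> w p = 1) ->
  completions i (occupy 1%N P) = fills z i (window 1 (c + (z - 1)) (hole_values 0 P l)).
  move=> count_i w1.
  have eq_occ : {in l, occupy 1%N P =1 P}.
    by move=> p lp; rewrite /occupy; case: eqP => // p1; rewrite -p1 lp in one'l.
  rewrite completions_fills ?nE.
  - rewrite /= (eq_hole_values _ eq_occ).
    rewrite -window_hole_values; congr (fills _ _ (window _ _ _)).
    by rewrite /c; ring.
  - rewrite /= add0n -count_i; apply: eq_in_count => p lp.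
    by congr (~~ _); apply: eq_occ.
  move=> p; rewrite inE => /predU1P[->|lp]; first by [].
  by rewrite eq_occ //; apply: w1.
suff sumE : forall i P, ~~ P 1%N -> count (predC P) l = i ->
    (forall p, p \in l -> ~~ P p -> w p = 1) ->
    hole_sum 0 P (fun p => completions i (occupy p P)) l =
    w 1%N * \sum_(j < i) (hole_values 0 P l)`_j
                          * gapped z i c (merge_at z j (hole_values 0 P l)).
  by move=> O1 count_k w1; rewrite completionsS // fill1 // sumE // -mulrDr.
move=> i; elim: i => [|i IHi] {k}{}O O1 count_i w1.
  by rewrite big_ord0 mulr0 hole_sum_full.
rewrite mulr_sumr.
have := hole_sum_merge (fun s => w 1%N * gapped z i.+1 c s) 0 uniq_l w1.
rewrite count_i => sumE; transitivity (
  \sum_(j < i.+1) (hole_values 0 O l)`_j *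
    (w 1%N * gapped z i.+1 c (merge_at z j (hole_values 0 O l)))); last first.
  by apply: eq_bigr => j _; rewrite mulrCA.
rewrite -sumE; apply: eq_hole_sum => p lp Op.
have occ1 : ~~ occupy p O 1%N.
  by rewrite negb_or O1 andbT; apply: contraNneq one'l => ->.
have count_occ : count (predC (occupy p O)) l = i.
  by move: count_i; rewrite (count_occupy _ lp Op) // => -[].
have w1_occ q : q \in l -> ~~ occupy p O q -> w q = 1.
  by move=> lq; rewrite negb_or => /andP[_]; apply: w1.
by rewrite completionsS // fill1 // IHi // -mulrDr.
Qed.

End Holes.

(** * Parking functions as feasible sequences *)

Section Feasible.
Variable n : nat.
Implicit Types (O : pred nat) (s : seq nat).

Definition landing O p := ohead [seq j <- iota p (n.+1 - p) | ~~ O j].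

Lemma landing_rec O p : (p <= n)%N ->
  landing O p = if O p then landing O p.+1 else Some p.
Proof. by move=> le_pn; rewrite /landing subSn //= subSS; case: (O p). Qed.

Lemma landing_out O p : (n < p)%N -> landing O p = None.
Proof. by rewrite /landing -subn_eq0 => /eqP ->. Qed.

Variant landing_spec O p : option nat -> Prop :=
  | Landed q of (p <= q <= n)%N & ~~ O q & (forall i, (p <= i < q)%N -> O i) :
      landing_spec O p (Some q)
  | NotLanded of (forall i, (p <= i <= n)%N -> O i) : landing_spec O p None.

Lemma landingP O p : landing_spec O p (landing O p).
Proof.
have [d] := ubnP (n.+1 - p)%N; elim: d p => // d IHd p lt_d.
have [le_pn|lt_np] := leqP p n; last first.
  by rewrite landing_out //; constructor => i; lia.
rewrite landing_rec //; case Op: (O p); last first.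
  by constructor; rewrite ?Op ?leqnn // => i; lia.
have [|q q_bnd Oq occ|occ] := IHd p.+1; first lia.
  constructor=> //; first lia.
  by move=> i i_bnd; have [->//|neq] := eqVneq i p; apply: occ; lia.
by constructor=> i i_bnd; have [->//|neq] := eqVneq i p; apply: occ; lia.
Qed.

Definition free O j := count (fun i => (j <= i)%N && ~~ O i) (iota 1 n).

(* Hall-type condition, preserved both ways when one car parks. *)
Definition feasible O s :=
  forall j, (0 < j)%N -> (count (leq j) s <= free O j)%N.

Lemma free_occupy O q j : (0 < q <= n)%N -> ~~ O q ->
  free O j = ((j <= q) + free (occupy q O) j)%N.
Proof.
move=> q_bnd Oq; rewrite /free.
have : q \in iota 1 n by rewrite mem_iota; lia.
have := iota_uniq 1 n; elim: (iota 1 n) => //= i l IHl /andP[i'l uniq_l].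
rewrite inE; have [eq_qi _|neq_qi] := eqVneq q i; rewrite /= /occupy.
  rewrite -eq_qi in i'l *; rewrite eqxx /= Oq andbT andbF add0n; congr addn.
  apply: eq_in_count => k lk /=.
  by case: eqP => //= kq; rewrite -kq lk in i'l.
move=> lq; rewrite eq_sym (negPf neq_qi) /= (IHl uniq_l lq) addnCA.
by rewrite /occupy.
Qed.

(** The bounds at [j <= p] and [j > q] change equally on both sides. For [p < j <= q] only the right
    side drops; there the bound at [p] suffices, since spots [p] to [q] are now all occupied and the
    free spots from [p] on lie beyond [j]. *)
Lemma feasible_landed O p s q : (0 < p)%N -> landing O p = Some q ->
  feasible O (p :: s) <-> feasible (occupy q O) s.
Proof.
move=> p_gt0; case: landingP => // {}q' /andP[le_pq le_qn] Oq occ [<-{q}].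
set q := q' in le_pq le_qn Oq occ *.
have freeE j := free_occupy j (_ : (0 < q <= n)%N) Oq.
have q_bnd : (0 < q <= n)%N by lia.
split=> feas j j_gt0; last first.
  by have := feas j j_gt0; rewrite /= freeE //; lia.
have [le_jp|lt_pj] := leqP j p.
  have := feas j j_gt0; rewrite /= freeE //; lia.
have [le_jq|lt_qj] := leqP j q; last first.
  have := feas j j_gt0; rewrite /= freeE //; lia.
have := feas p p_gt0; rewrite /= freeE // le_pq leqnn leq_add2l => le_p.
have le_js : (count (leq j) s <= count (leq p) s)%N.
  by apply: sub_count => i /=; lia.
apply: leq_trans (leq_trans le_js le_p) _; apply: sub_count => i /andP[le_pi].
rewrite /occupy negb_or => /andP[neq_iq Oi]; rewrite neq_iq Oi !andbT.
rewrite leqNgt; apply/negP => lt_ij; move/negP: Oi; apply; apply: occ; lia.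
Qed.

Lemma infeasible O p s : (0 < p)%N -> landing O p = None -> ~ feasible O (p :: s).
Proof.
move=> p_gt0; case: landingP => // occ _ /(_ p p_gt0); rewrite /= leqnn.
suff -> : free O p = 0%N by [].
apply/eqP; rewrite -leqn0 leqNgt -has_count; apply/hasPn => i.
by rewrite mem_iota => i_bnd; apply/negP => /andP[le_pi /negP]; apply; apply: occ; lia.
Qed.

Lemma count_geq_iota j m : (0 < j)%N -> count (leq j) (iota 1 m) = (m.+1 - j)%N.
Proof.
move=> j_gt0; elim: m => [|m IHm]; first by rewrite /=; lia.
by rewrite -[X in iota _ X]addn1 iotaD count_cat IHm /=; lia.
Qed.

Lemma parkingP s : size s = n -> all (leq 1) s ->
  reflect (feasible pred0 s) (parking s).
Proof.
move=> sz_s pos_s; rewrite /parking pos_s /=.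
set t := sort leq s; have sz_t : size t = n by rewrite size_sort.
have freeE j : (0 < j)%N -> free pred0 j = (n.+1 - j)%N.
  move=> j_gt0; rewrite -count_geq_iota //.
  by apply: eq_count => i /=; rewrite andbT.
have countE j : count (leq j) s = count (leq j) t.
  by apply/permP; rewrite perm_sym perm_sort.
apply: (iffP forallP) => [le_t j j_gt0|feas i].
  rewrite countE freeE // -(cat_take_drop j.-1 t) count_cat.
  (* Entry i < j - 1 of [t] is at most i + 1 < j. *)
  have -> : count (leq j) (take j.-1 t) = 0%N.
    apply/eqP; rewrite -leqn0 leqNgt -has_count; apply/hasPn => k.
    case/(nthP 0%N) => i; rewrite size_take sz_t => lt_i <-.
    have lt_in : (i < size s)%N by move: lt_i; rewrite sz_s; case: ifP; lia.
    have := le_t (Ordinal lt_in); rewrite /= nth_take -/t; last by move: lt_i; case: ifP; lia.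
    by move: lt_i; case: ifP; lia.
  rewrite add0n (leq_trans (count_size _ _)) // size_drop sz_t; lia.
rewrite leqNgt; apply/negP => lt_ti; 
have lt_in : (i < n)%N by rewrite -sz_s ltn_ord.
(* The last n - i entries of [t] are at least i + 2, but only n - i - 1 spots are. *)
have := feas i.+2 isT; rewrite freeE // countE -(cat_take_drop i t) count_cat.
have -> : count (leq i.+2) (drop i t) = (n - i)%N.
  rewrite -sz_t -size_drop; apply/eqP; rewrite -all_count.
  apply/(all_nthP 0%N) => k; rewrite size_drop sz_t nth_drop => lt_k.
  apply: leq_trans lt_ti _; apply: sorted_leq_nth; rewrite ?inE ?sz_t ?leq_addr //; try lia.
  - exact: leq_trans.
  - exact: sort_sorted leq_total _.
by lia.
Qed.

End Feasible.

(** * Weights of preference sequences *)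

Section Weights.
Variables (R : comNzRingType) (z : R) (w : nat -> R) (n : nat).
Hypothesis w0 : w 0 = 0.
Implicit Types (O : pred nat) (f : nat -> R) (s : seq nat).

(** A car that cannot park makes the weight 0, so that sums may range over all tuples. *)
Fixpoint weight O s : R :=
  if s is p :: s' then
    w p * (if landing n O p is Some q then z ^+ (q != p) * weight (occupy q O) s'
           else 0)
  else 1.

Lemma eq_landing O O' p : O =1 O' -> landing n O p = landing n O' p.
Proof. by move=> eqO; congr ohead; apply: eq_filter => j; rewrite eqO. Qed.

Lemma eq_weight O O' s : O =1 O' -> weight O s = weight O' s.
Proof.
elim: s O O' => //= p s IHs O O' eqO; rewrite (eq_landing p eqO).
case: landing => // q; congr (_ * (_ * _)); apply: IHs => i.
by rewrite /occupy eqO.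
Qed.

Lemma nth_outcome (occ : seq (option nat)) s i : (i < size occ)%N ->
  nth None (foldl (park_car n) occ s) i = nth None occ i.
Proof.
elim: s occ => //= p s IHs occ lt_i.
by rewrite IHs /park_car ?size_rcons 1?leqW // nth_rcons lt_i.
Qed.

Lemma weight_feasible (occ : seq (option nat)) s
    (O := fun j => Some j \in occ) (occs := foldl (park_car n) occ s) :
  all (leq 1) s ->
  (~ feasible n O s -> weight O s = 0) /\
  (feasible n O s -> weight O s =
     \prod_(p <- s) w p *
     z ^+ \sum_(i < size s) (nth None occs (size occ + i) != Some (nth 0%N s i))).
Proof.
rewrite {}/O {}/occs; elim: s occ => [|p s IHs] occ.
  by move=> _; split=> /= [[]|_]; rewrite // big_nil big_ord0 mulr1.
move=> /= /andP[p_gt0 pos_s]; set O := fun j => Some j \in occ.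
have -> : park_car n occ p = rcons occ (landing n O p) by [].
case land: (landing n O p) => [q|]; last first.
  by split=> [_|feas]; [rewrite mulr0 | case: (infeasible p_gt0 land feas)].
have [] := IHs (rcons occ (Some q)) pos_s.
have eqO : occupy q O =1 fun j => Some j \in rcons occ (Some q).
  by move=> j; rewrite mem_rcons inE.
have feasE : feasible n O (p :: s) <->
    feasible n (fun j => Some j \in rcons occ (Some q)) s.
  rewrite (feasible_landed _ p_gt0 land) /feasible /free.
  by split=> feas j j_gt0; rewrite (leq_trans (feas j j_gt0)) //;
    apply/eq_leq/eq_count => i; rewrite /= eqO.
rewrite -!(eq_weight s eqO) => wt0 wtE; split=> [nfeas|/feasE feas].
  by rewrite wt0 ?mulr0 // => /feasE.
rewrite wtE // big_cons big_ord_recl addn0 nth_outcome ?size_rcons //.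
rewrite nth_rcons ltnn eqxx exprD [nth _ _ _]/= [Some q == _]/(q == p).
set occs := foldl _ _ _.
have -> : (\sum_(i < size s) (nth None occs (size occ + lift ord0 i)
             != Some (nth 0 (p :: s) (lift ord0 i))))%N =
    (\sum_(i < size s) (nth None occs ((size occ).+1 + i) != Some (nth 0 s i)))%N.
  by apply: eq_bigr => i _; rewrite lift0 addSnnS.
ring.
Qed.

Lemma weight_parking s : size s = n ->
  weight pred0 s = if parking s then \prod_(p <- s) w p * z ^+ unl s else 0.
Proof.
move=> sz_s; have [pos_s|] := boolP (all (leq 1) s); last first.
  move=> npos_s; rewrite /parking (negPf npos_s).
  elim: s (pred0 : pred nat) npos_s {sz_s} => //= p s IHs O.
  case: p => [|p]; first by rewrite w0 mul0r.
  by case: landing => [q /IHs ->|]; rewrite !mulr0.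
have [wt0 wtE] := @weight_feasible [::] s pos_s.
case: (parkingP sz_s pos_s) => feas; last exact: wt0.
by move: (wtE feas); rewrite /unl /outcome !sz_s.
Qed.

(** Preferences are grouped by landing spot. Those in the block just before [a], of total weight
    [acc], land where preference [a] does and are all displaced, whence [z * acc]. Since
    [a + l = n.+1], a block at the end of the list leads nowhere. *)
Lemma sum_landing O f acc a l : (a + l = n.+1)%N ->
  \sum_(p <- iota a l)
     w p * (if landing n O p is Some q then z ^+ (q != p) * f q else 0)
  + z * acc * (if landing n O a is Some q then f q else 0)
  = hole_sum z w acc O f (iota a l).
Proof.
elim: l acc a => [|l IHl] acc a a_l.
  by rewrite big_nil add0r landing_out ?mulr0 //; lia.
have a_l' : (a.+1 + l = n.+1)%N by lia.
rewrite big_cons /= landing_rec; last lia.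
case Oa: (O a); last first.
  rewrite -IHl // eqxx expr0; ring.
rewrite -IHl //; case: landingP => [q q_bnd _ _|_]; last by ring.
have -> : (q != a)%N by apply/eqP; lia.
rewrite expr1; ring.
Qed.

Lemma sum_landing_ord O f :
  \sum_(p < n.+1)
     w p * (if landing n O p is Some q then z ^+ (q != p) * f q else 0)
  = hole_sum z w 0 O f (iota 1 n).
Proof.
rewrite -sum_landing // mulr0 mul0r addr0.
rewrite big_ord_recl w0 mul0r add0r.
have -> : iota 1 n = index_iota 1 n.+1 by rewrite /index_iota subn1.
by rewrite big_add1 big_mkord.
Qed.

Lemma sum_tuple_cons (T : finType) k (F : k.+1.-tuple T -> R) :
  \sum_t F t = \sum_p \sum_(t : k.-tuple T) F [tuple of p :: t].
Proof.
rewrite pair_big /=.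
rewrite (reindex (fun u : T * k.-tuple T => [tuple of u.1 :: u.2])) //=.
exists (fun t => (thead t, [tuple of behead t])) => [[p t] _|t _] /=.
  by congr pair; apply: val_inj.
by rewrite [RHS]tuple_eta.
Qed.

Lemma sum_weight k O :
  \sum_(t : k.-tuple 'I_n.+1) weight O (map val t) = completions z w n k O.
Proof.
elim: k O => [|k IHk] O.
  rewrite (eq_bigr (fun=> 1)) => [|t _]; last by rewrite tuple0.
  by rewrite sumr_const card_tuple.
rewrite sum_tuple_cons [RHS]/= -sum_landing_ord.
apply: eq_bigr => p _ /=; rewrite -mulr_sumr; congr (_ * _).
case: landing => [q|]; last by rewrite big1.
by rewrite -mulr_sumr IHk.
Qed.

Lemma weight_cons O p s : (p <= n)%N -> O p = false ->
  weight O (p :: s) = w p * weight (occupy p O) s.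
Proof. by move=> le_pn Op; rewrite /= landing_rec // Op eqxx mul1r. Qed.

(** On an empty street two cars with distinct preferences both park where they wish, so their order
    is immaterial. *)
Lemma weight_swap p q s : (p <= n)%N -> (q <= n)%N ->
  weight pred0 [:: p, q & s] = weight pred0 [:: q, p & s].
Proof.
move=> le_pn le_qn; have [->//|neq_pq] := eqVneq p q.
have occ_pq : occupy p pred0 q = false by rewrite /occupy eq_sym (negPf neq_pq).
have occ_qp : occupy q pred0 p = false by rewrite /occupy (negPf neq_pq).
rewrite !weight_cons // mulrCA; do 2!congr (_ * _); apply: eq_weight => i.
by rewrite /occupy !orbF orbC.
Qed.

End Weights.

(** * The enumerator *)

Section Enumerator.
Variables (R : comNzRingType) (x y z : R).

(* The value 0 at p = 0 discards the tuples that use the preference 0. *)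
Definition pref_weight j p : R :=
  if p == 0%N then 0 else x ^+ (p == j) * y ^+ (p == 1%N).

Lemma prod_pref_weight j s : all (leq 1) s ->
  \prod_(p <- s) pref_weight j p = x ^+ count_mem j s * y ^+ count_mem 1%N s.
Proof.
elim: s => [|p s IHs] /=; first by rewrite big_nil mulr1.
case/andP=> p_gt0 pos_s; rewrite big_cons IHs // /pref_weight gtn_eqF //.
by rewrite !exprD mulrACA.
Qed.

(** The weights depend on the preference [q] of the second car. After [weight_swap] this car comes
    first and parks at [q]; [completions] accounts for the other [m.+1] cars. *)
Lemma sum_PF_lel m (n := m.+2) :
  \sum_(t in PF n)
     x ^+ nlel (parkseq t) * y ^+ ones (parkseq t) * z ^+ unl (parkseq t) =
  \sum_(q < n.+1)
     pref_weight q q * completions z (pref_weight q) n m.+1 (occupy q pred0).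
Proof.
pose W (q : 'I_n.+1) := weight z (pref_weight q) n pred0.
transitivity (\sum_(p < n.+1) \sum_(q < n.+1) \sum_(t : m.-tuple 'I_n.+1)
    W q [:: p : nat, q : nat & map val t]).
  transitivity (\sum_(t : n.-tuple 'I_n.+1) W (tnth t 1) (parkseq t)).
    rewrite big_mkcond; apply: eq_bigr => t _.
    rewrite /W weight_parking // ?size_map ?size_tuple // inE.
    case: ifP => // park_t; rewrite prod_pref_weight; last by case/andP: park_t.
    have -> // : nat_of_ord (tnth t 1) = nth 0%N (parkseq t) 1.
    by rewrite (tnth_nth 0) (nth_map 0) ?size_tuple.
  rewrite sum_tuple_cons; apply: eq_bigr => p _.
  rewrite sum_tuple_cons; apply: eq_bigr => q _.
  by apply: eq_bigr => t _; rewrite /parkseq (tnth_nth 0).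
rewrite exchange_big; apply: eq_bigr => q _.
rewrite -sum_weight // sum_tuple_cons mulr_sumr.
apply: eq_bigr => p _; rewrite mulr_sumr.
apply: eq_bigr => t _.
have le_n (i : 'I_n.+1) : (i <= n)%N by rewrite -ltnS.
by rewrite /W weight_swap ?le_n // weight_cons ?le_n.
Qed.

Lemma hole_values_ones w acc O l : {in l, forall p, ~~ O p /\ w p = 1 :> R} ->
  hole_values z w acc O l = 1 + z * acc :: nseq (size l) 1.
Proof.
elim: l acc => //= p l IHl acc free_l.
have [/negPf -> ->] := free_l p (mem_head _ _).
rewrite IHl ?mulr0 ?addr0 // => q lq; apply: free_l; exact: mem_behead.
Qed.

Lemma hole_values_cat_ones w O l1 l2 : {in l1, forall p, ~~ O p /\ w p = 1 :> R} ->
  hole_values z w 0 O (l1 ++ l2) = nseq (size l1) 1 ++ hole_values z w 0 O l2.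
Proof.
elim: l1 => //= p l IHl free_l.
have [/negPf -> ->] := free_l p (mem_head _ _).
rewrite IHl ?mulr0 ?addr0 // => q lq; apply: free_l; exact: mem_behead.
Qed.

(** The car at spot 1 is a block of weight [x * y], so the values are [1 + z * (x * y)] followed by
    ones, as in [fills_cons_nseq]. *)
Lemma completions_one m (n := m.+2) :
  completions z (pref_weight 1) n m.+1 (occupy 1%N pred0) =
  (x * y * z + 1) *
    \prod_(1 <= i < m.+1) (x * y * z + i%:R * z + (n - i)%:R).
Proof.
have free_tl p : p \in iota 2 m.+1 ->
    ~~ occupy 1%N pred0 p /\ pref_weight 1 p = 1.
  rewrite mem_iota /occupy /pref_weight => p_bnd.
  have [-> ->] : (p == 1%N) = false /\ (p == 0%N) = false by lia.
  by rewrite /= !expr0 mulr1.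
have : size (iota 2 m.+1) = m.+1 by rewrite size_iota.
have : iota 1 n = 1%N :: iota 2 m.+1 by [].
move: (iota 2 m.+1) free_tl => l free_tl lE sz_l.
rewrite (completions_fills z) lE.
- rewrite [hole_values _ _ _ _ _]/= hole_values_ones // sz_l fills_cons_nseq add0r.
  have -> : 1 + z * pref_weight 1 1 = x * y * z + 1.
    by rewrite /pref_weight /= !expr1; ring.
  rewrite big_nat [in RHS]big_nat; congr (_ * _).
  apply: eq_bigr => i i_bnd; rewrite natrB; last lia.
  rewrite /n -[m.+2]addn1 natrD; ring.
- rewrite /= add0n -[RHS]sz_l; apply/eqP; rewrite -all_count.
  by apply/allP => p /free_tl[].
by move=> p; rewrite inE => /predU1P[->|/free_tl[]].
Qed.

(** Once spot [i.+2] is taken, the values behind spot 1 are ones except for [1 + z * x] just after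
    the taken spot. As [i] varies they run through the rotations of [s]; for [i = m] the exceptional
    value sits at the extra spot. *)
Lemma sum_completions_ge2 m (n := m.+2) :
  \sum_(i < m.+1) completions z (pref_weight i.+2) n m.+1 (occupy i.+2 pred0) =
  y * (m.+1%:R *
    \prod_(1 <= i < m.+1) (x * z + y * z + (i - 1)%:R * z + (n - i)%:R)).
Proof.
pose s := 1 + z * x :: nseq m 1.
pose c := 1 + z * y - z.
transitivity (\sum_(i < m.+1) y * gapped z m.+1 c (rotr i s)).
  apply: eq_bigr => i _.
  have free_ne p : p \in iota 2 m.+1 -> p != i.+2 ->
      ~~ occupy i.+2 pred0 p /\ pref_weight i.+2 p = 1.
    rewrite mem_iota /occupy /pref_weight => p_bnd /negPf ->.
    have [-> ->] : (p == 1%N) = false /\ (p == 0%N) = false by lia.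
  by rewrite /= !expr0 mulr1.
  have le_im : (i <= m)%N by rewrite -ltnS.
  have iotaE : iota 2 m.+1 = iota 2 i ++ i.+2 :: iota i.+3 (m - i).
    have mE : (i + (m - i).+1)%N = m.+1 by lia.
    by have := iotaD 2 i (m - i).+1; rewrite mE => ->.
  have w1 : pref_weight i.+2 1 = y by rewrite /pref_weight mul1r.
  have wi : pref_weight i.+2 i.+2 = x by rewrite /pref_weight /= eqxx mulr1.
  have count_m : count (predC (occupy i.+2 pred0)) (iota 2 m.+1) = m.
    have i_in : i.+2 \in iota 2 m.+1 by rewrite mem_iota; have := ltn_ord i; lia.
    have := @count_occupy _ pred0 _ (iota_uniq 2 m.+1) i_in isT.
    by rewrite (@eq_count _ _ predT) // count_predT size_iota => -[].
  have w_free p : p \in iota 2 m.+1 -> ~~ occupy i.+2 pred0 p ->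
      pref_weight i.+2 p = 1.
    by move=> p_in; rewrite /occupy orbF => /(free_ne p p_in)[].
  have := @completions_gapped _ z _ n m (occupy i.+2 pred0) isT isT count_m w_free.
  rewrite w1 => ->; congr (_ * gapped _ _ _ _); rewrite [n.-1]/=.
  rewrite rotr_cons_nseq // iotaE hole_values_cat_ones.
    rewrite size_iota /= /occupy eqxx /= -/(occupy i.+2 pred0) wi add0r.
    rewrite hole_values_ones ?size_iota // => p p_in.
    by apply: free_ne; move: p_in; rewrite !mem_iota; lia.
  move=> p p_in; apply: free_ne; move: p_in; rewrite !mem_iota; lia.
rewrite -mulr_sumr; congr (_ * _).
have sz_s : size s = m.+1 by rewrite /= size_nseq.
have sum_s : \sum_(a <- s) a = m.+1%:R + z * x.
  by rewrite big_cons big_nseq iter_addr_0 -addn1 natrD; ring.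
have := sum_rotr (gapped z m.+1 c) s; rewrite sz_s => ->.
have := sum_rot_gapped z c sz_s; rewrite sz_s sum_s => ->; congr (_ * _).
rewrite big_nat [in RHS]big_nat; apply: eq_bigr => i i_bnd.
rewrite !natrB; try lia; rewrite /c /n -[m.+2]addn1 natrD; ring.
Qed.

End Enumerator.

Theorem theorem4p7 (R : comNzRingType) (x y z : R) (n : nat) (hn : (2 <= n)%N) :
  \sum_(t in PF n)
     x ^+ nlel (parkseq t) * y ^+ ones (parkseq t) * z ^+ unl (parkseq t)
  = x * y *
    ((n - 1)%:R *
       \prod_(1 <= i < n.-1)
          (x * z + y * z + (i - 1)%:R * z + (n - i)%:R)
     + (x * y * z + 1) *
       \prod_(1 <= i < n.-1)
          (x * y * z + i%:R * z + (n - i)%:R)).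
Proof.
case: n hn => [|[|m]] // _.
(* Preference 0 contributes nothing, preference 1 weighs [x * y] and gives the second product, and
   the others weigh [x] and give the first. *)
rewrite sum_PF_lel big_ord_recl mul0r add0r big_ord_recl completions_one.
rewrite [_ * (_ * _)]mulrC addrC.
rewrite (eq_bigr (fun i : 'I_m.+1 => x *
  completions z (pref_weight x y i.+2) m.+2 m.+1 (occupy i.+2 pred0))).
  rewrite -mulr_sumr sum_completions_ge2 subn1 /= /pref_weight /= !expr1; ring.
by move=> i _; rewrite /pref_weight /= eqxx mulr1.
Qed.
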